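(* Let $l=7$, $r\in\{1,2,3\}$ and $a=[r]$. Then $p_{4,1}(1/a)$, $p_{8,3}(1/a)$ and $p_{16,6}(1/a)$ are in $S$.
   Context: For an integer $i$, $[i]=\sum x^{n^2}\in\mathbb{Z}/2[[x]]$, summed over $n\in\mathbb{Z}$ with $n\equiv i\pmod 7$. $S$ is the subring of $\mathbb{Z}/2[[x]]$ generated over $\mathbb{Z}/2$ by $[1],[2],[3]$. $1/a$ is taken in the field $L$ of Laurent series over $\mathbb{Z}/2$. For $q$ a power of $2$ and $0\le j<q$, $p_{q,j}:L\to L$ is $\sum_n c_nx^n\mapsto\sum_{n\equiv j\pmod q}c_nx^n$. *)

(* Defs.v *)
From HB Require Import structures.
From mathcomp Require Import all_boot all_order all_algebra.
From mathcomp Require Import mathcomp_extra boolp classical_sets functions.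
From mathcomp Require Import cardinality fsbigop.
From mathcomp Require Import zify.

Set Warnings "-redundant-canonical-projection".
Set Implicit Arguments.
Unset Strict Implicit.
Unset Printing Implicit Defensive.

Import Order.TTheory GRing.Theory Num.Theory.
Local Open Scope classical_set_scope.
Local Open Scope ring_scope.

(* The field F((x)) of formal Laurent series over a field F. *)

Definition bounded_below (F : fieldType) (c : int -> F) : Prop :=
  exists N : int, forall n : int, n < N -> c n = 0.

Record laurent (F : fieldType) : Type := Laurent {
  lcoef :> int -> F;
  lcoefP : `[< bounded_below lcoef >] }.

HB.instance Definition _ (F : fieldType) := [isSub for @lcoef F].
HB.instance Definition _ (F : fieldType) := [Choice of laurent F by <:].

Section LaurentField.
Variable F : fieldType.
Implicit Types (f g h : laurent F) (c : int -> F) (N M m n : int).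

Definition mklaurent c (cP : bounded_below c) : laurent F := Laurent (asboolT cP).

Lemma le_addnat m n : m <= n -> exists k : nat, n = m + k%:Z.
Proof. by move=> mn; exists (absz (n - m)%R); lia. Qed.

Lemma laurentP f g : (forall n, f n = g n) -> f = g.
Proof. by move=> fg; apply/val_inj/funext. Qed.

Lemma lbound f : exists N, forall n, n < N -> f n = 0.
Proof. exact: asboolW (lcoefP f). Qed.

Fact lconst_subproof (a : F) : bounded_below (fun n => if n == 0 then a else 0).
Proof. by exists 0 => n; case: eqP => [->|]. Qed.
Definition lconst a : laurent F := mklaurent (lconst_subproof a).

Fact lopp_subproof f : bounded_below (fun n => - f n).
Proof. by have [N fN] := lbound f; exists N => n /fN ->; rewrite oppr0. Qed.
Definition lopp f : laurent F := mklaurent (lopp_subproof f).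

Fact ladd_subproof f g : bounded_below (fun n => f n + g n).
Proof.
have [N fN] := lbound f; have [M gM] := lbound g.
by exists (Num.min N M) => n; rewrite lt_min => /andP[/fN -> /gM ->]; rewrite addr0.
Qed.
Definition ladd f g : laurent F := mklaurent (ladd_subproof f g).

Fact lscale_subproof (a : F) f : bounded_below (fun n => a * f n).
Proof. by have [N fN] := lbound f; exists N => n /fN ->; rewrite mulr0. Qed.
Definition lscale a f : laurent F := mklaurent (lscale_subproof a f).

(* Only finitely many terms of the convolution are nonzero. *)
Definition lmul_coef f g (n : int) : F := \sum_(i \in [set: int]) (f i * g (n - i)).

Fact lmul_subproof f g : bounded_below (lmul_coef f g).
Proof.
have [N fN] := lbound f; have [M gM] := lbound g.
exists (N + M) => n ltn; rewrite /lmul_coef fsbig1// => i _.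
have [/fN ->|leNi] := ltP i N; first by rewrite mul0r.
by rewrite gM ?mulr0//; lia.
Qed.
Definition lmul f g : laurent F := mklaurent (lmul_subproof f g).

Lemma lmulE f g N M (k : nat) :
    (forall n, n < N -> f n = 0) -> (forall n, n < M -> g n = 0) ->
  lmul f g (N + M + k%:Z) =
    \sum_(i < k.+1) f (N + i%:Z) * g (M + (k - i)%N%:Z).
Proof.
move=> fN gM; rewrite /= /lmul_coef.
rewrite -(@fsbig_widen _ _ _ _ [set N + i%:Z | i in `I_k.+1]) //; last first.
  move=> i [_ /= ni]; have [/fN ->|leNi] := ltP i N; first by rewrite mul0r.
  have [kN|Nk] := leP i (N + k%:Z); last by rewrite gM ?mulr0//; lia.
  by exfalso; apply: ni; exists (absz (i - N)%R); lia.
rewrite fsbig_image; last by move=> i j _ _ /addrI[].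
rewrite -[LHS](fsbig_ord _ _ (fun i => f (N + i%:Z) * g (N + M + k%:Z - (N + i%:Z)))).
by apply: eq_bigr => -[i /= lti] _; congr (_ * g _); lia.
Qed.

Lemma lmul_eq0 f g N M :
    (forall n, n < N -> f n = 0) -> (forall n, n < M -> g n = 0) ->
  forall n, n < N + M -> lmul f g n = 0.
Proof.
move=> fN gM n ltn; rewrite /= /lmul_coef fsbig1// => i _.
have [/fN ->|leNi] := ltP i N; first by rewrite mul0r.
by rewrite gM ?mulr0//; lia.
Qed.

Let trunc f N (k : nat) : {poly F} := \poly_(i < k.+1) f (N + i%:Z).

Let lmul_trunc f g N M (k j : nat) :
    (forall n, n < N -> f n = 0) -> (forall n, n < M -> g n = 0) ->
  (j <= k)%N -> lmul f g (N + M + j%:Z) = (trunc f N k * trunc g M k)`_j.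
Proof.
move=> fN gM jk; rewrite (lmulE _ fN gM) coefM; apply: eq_bigr => -[i /= lti] _.
by rewrite !coef_poly; do 2 (case: ifP => ?; last lia).
Qed.

Lemma laddA : associative ladd.
Proof. by move=> f g h; apply: laurentP => n /=; rewrite addrA. Qed.
Lemma laddC : commutative ladd.
Proof. by move=> f g; apply: laurentP => n /=; rewrite addrC. Qed.
Lemma ladd0 : left_id (lconst 0) ladd.
Proof. by move=> f; apply: laurentP => n /=; rewrite if_same add0r. Qed.
Lemma laddN : left_inverse (lconst 0) lopp ladd.
Proof. by move=> f; apply: laurentP => n /=; rewrite addNr if_same. Qed.
HB.instance Definition _ :=
  GRing.isZmodule.Build (laurent F) laddA laddC ladd0 laddN.

Lemma lmulC : commutative lmul.
Proof.
move=> f g; have [N fN] := lbound f; have [M gM] := lbound g.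
apply: laurentP => n; have [ltn|leNn] := ltP n (N + M).
  by rewrite (lmul_eq0 fN gM)// (lmul_eq0 gM fN)// addrC.
have [k ->] := le_addnat leNn.
by rewrite (lmul_trunc fN gM (leqnn k)) [N + M]addrC (lmul_trunc gM fN (leqnn k)) mulrC.
Qed.

Lemma lmulA : associative lmul.
Proof.
move=> f g h; have [N fN] := lbound f; have [M gM] := lbound g.
have [P hP] := lbound h; have fg := lmul_eq0 fN gM; have gh := lmul_eq0 gM hP.
apply: laurentP => n; have [ltn|leNn] := ltP n (N + M + P).
  by rewrite (lmul_eq0 fg hP)// (lmul_eq0 fN gh)// addrA.
have [k ->] := le_addnat leNn.
rewrite (lmulE _ fg hP) -(addrA N) (lmulE _ fN gh).
transitivity ((trunc f N k * trunc g M k * trunc h P k)`_k).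
  rewrite -mulrA coefM; apply: eq_bigr => -[i /= lti] _.
  by rewrite -(lmul_trunc gM hP) ?leq_subr// coef_poly lti.
rewrite coefM; apply: eq_bigr => -[i /= lti] _.
by rewrite -(lmul_trunc fN gM)// coef_poly ltnS leq_subr.
Qed.

Lemma lmul1 : left_id (lconst 1) lmul.
Proof.
move=> f; apply: laurentP => n.
rewrite /= /lmul_coef -(@fsbig_widen _ _ _ _ [set 0])//=.
  by rewrite fsbig_set1 eqxx mul1r subr0.
by move=> i [_ /= /eqP/negPf ->]; rewrite mul0r.
Qed.

Lemma lmulDl : left_distributive lmul ladd.
Proof.
move=> f g h; have [N fN] := lbound f; have [M gM] := lbound g.
have [P hP] := lbound h; pose Q := Num.min N M.
have fQ n : n < Q -> f n = 0 by rewrite lt_min => /andP[/fN].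
have gQ n : n < Q -> g n = 0 by rewrite lt_min => /andP[_ /gM].
have fgQ n : n < Q -> ladd f g n = 0 by move=> nQ; rewrite /= fQ ?gQ ?addr0.
apply: laurentP => n; rewrite [RHS]/=; have [ltn|leNn] := ltP n (Q + P).
  have := lmul_eq0 fgQ hP ltn => ->.
  have := lmul_eq0 fQ hP ltn => /= ->; have := lmul_eq0 gQ hP ltn => /= ->.
  by rewrite addr0.
have [k ->] := le_addnat leNn.
rewrite (lmulE _ fgQ hP).
have := lmulE k fQ hP => /= ->; have := lmulE k gQ hP => /= ->.
by rewrite -big_split; apply: eq_bigr => i _; rewrite /= mulrDl.
Qed.

Lemma lone_neq0 : lconst 1 != 0.
Proof.
by apply/eqP => /(congr1 (fun f : laurent F => f 0))/eqP; rewrite /= oner_eq0.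
Qed.

HB.instance Definition _ :=
  GRing.Zmodule_isComNzRing.Build (laurent F) lmulA lmulC lmul1 lmulDl lone_neq0.

Lemma lscaleA a b f : lscale a (lscale b f) = lscale (a * b) f.
Proof. by apply: laurentP => n /=; rewrite mulrA. Qed.
Lemma lscale1 : left_id 1 lscale.
Proof. by move=> f; apply: laurentP => n /=; rewrite mul1r. Qed.
Lemma lscaleDr : right_distributive lscale +%R.
Proof. by move=> a f g; apply: laurentP => n /=; rewrite mulrDr. Qed.
Lemma lscaleDl f : {morph lscale^~ f : a b / a + b}.
Proof. by move=> a b; apply: laurentP => n /=; rewrite mulrDl. Qed.
HB.instance Definition _ := GRing.Zmodule_isLmodule.Build F (laurent F)
  lscaleA lscale1 lscaleDr lscaleDl.

Lemma lscaleAl (a : F) f g : a *: (f * g) = a *: f * g.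
Proof.
have [N fN] := lbound f; have [M gM] := lbound g.
have afN n : n < N -> lscale a f n = 0 by move=> nN; rewrite /= fN ?mulr0.
apply: laurentP => n; have [ltn|leNn] := ltP n (N + M).
  have := lmul_eq0 afN gM ltn => ->; have := lmul_eq0 fN gM ltn => /= ->.
  by rewrite mulr0.
have [k ->] := le_addnat leNn.
have := lmulE k afN gM => ->; have := lmulE k fN gM => /= ->.
by rewrite mulr_sumr; apply: eq_bigr => i _; rewrite mulrA.
Qed.
HB.instance Definition _ :=
  GRing.Lmodule_isLalgebra.Build F (laurent F) lscaleAl.
HB.instance Definition _ :=
  GRing.Lalgebra_isComAlgebra.Build F (laurent F).

Lemma linv_exists f : f != 0 -> exists g, g * f = 1.
Proof.
move=> f_neq0; have [N fN] := lbound f.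
have [n0 fn0] : exists n, f n != 0.
  apply/not_existsP => f0; move/eqP: f_neq0; apply; apply: laurentP => n /=.
  by rewrite if_same; apply/eqP/negPn/negP; exact: f0.
have exk : exists k : nat, f (N + k%:Z) != 0.
  have [/fN n0E|leN] := ltP n0 N; first by rewrite n0E eqxx in fn0.
  by have [k n0E] := le_addnat leN; exists k; rewrite -n0E.
case: (ex_minnP exk) => k0 fk0 k0min; pose V := N + k0%:Z.
have fV n : n < V -> f n = 0.
  move=> nV; have [/fN //|leN] := ltP n N; apply/eqP/negPn/negP => fn.
  have [k nE] := le_addnat leN; move: fn; rewrite nE => /k0min.
  by move: nV; rewrite nE /V; lia.
pose u (i : nat) := f (V + i%:Z).
have u0 : u 0%N != 0 by rewrite /u addr0.
pose step (s : seq F) := (u 0%N)^-1 *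
  ((size s == 0%N)%:R - \sum_(i < size s) s`_i * u (size s - i)%N).
pose hs k := iter k (fun s => rcons s (step s)) [::].
have size_hs k : size (hs k) = k.
  by elim: k => //= k IH; rewrite size_rcons IH.
pose v k := step (hs k).
have hsE k i : (i < k)%N -> (hs k)`_i = v i.
  elim: k => //= k IH; rewrite nth_rcons size_hs ltnS leq_eqVlt.
  by case: ltngtP => //= [ik _|-> _]; [exact: IH|].
have vE k : \sum_(i < k.+1) v i * u (k - i)%N = (k == 0%N)%:R.
  rewrite big_ord_recr /= subnn {2}/v /step size_hs mulrAC mulVf// mul1r.
  rewrite addrC -[RHS]subr0 -addrA; congr (_ + _).
  rewrite oppr0 addrC; apply/eqP; rewrite subr_eq0; apply/eqP.
  by apply: eq_bigr => -[i lti] _ /=; rewrite hsE.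
have gP : bounded_below
    (fun n => if n < - V then 0 else v (absz (n + V)%R)).
  by exists (- V) => n ->.
pose g := mklaurent gP.
have gV n : n < - V -> g n = 0 by move=> nV; rewrite /= nV.
exists g; apply: laurentP => n; have [ltn|leNn] := ltP n (- V + V).
  have := lmul_eq0 gV fV ltn => ->; rewrite addNr in ltn.
  by rewrite /= lt_eqF.
have [k ->] := le_addnat leNn; have := lmulE k gV fV => ->.
transitivity (\sum_(i < k.+1) v i * u (k - i)%N); last first.
  by rewrite vE /= addNr add0r; case: k.
apply: eq_bigr => -[i lti] _ /=; congr (_ * _).
case: ifP => [|_]; first lia.
by congr v; lia.
Qed.

Definition linv f : laurent F :=
  if pselect (exists g, g * f = 1) is left e then projT1 (cid e) else 0.

Lemma lmulV f : f != 0 -> linv f * f = 1.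
Proof.
by move=> /linv_exists e; rewrite /linv; case: pselect => // e'; case: cid.
Qed.
Lemma linv0 : linv 0 = 0.
Proof.
rewrite /linv; case: pselect => // e; exfalso; case: e => g /eqP.
by rewrite mulr0 eq_sym oner_eq0.
Qed.
HB.instance Definition _ := GRing.ComNzRing_isField.Build (laurent F) lmulV linv0.

Fact lproj_subproof (q j : nat) f :
  bounded_below (fun n => if (n == j%:Z %[mod q%:Z])%Z then f n else 0).
Proof. by have [N fN] := lbound f; exists N => n /fN ->; rewrite if_same. Qed.

Definition lproj (q j : nat) f : laurent F := mklaurent (lproj_subproof q j f).

End LaurentField.

(* The coefficient of x^m counts the n = i mod l with n^2 = m: for m > 0, both
   n and -n count when both are congruent to i. *)
Definition theta_coef (l : nat) (i m : int) : 'F_2 :=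
  \sum_(n \in [set n : int | (n = i %[mod l%:Z])%Z /\ n ^+ 2 = m]) (1 : 'F_2).

Fact theta_subproof (l : nat) (i : int) : bounded_below (theta_coef l i).
Proof.
exists 0 => m m0; rewrite /theta_coef (_ : mkset _ = set0) ?fsbig_set0//.
by apply/seteqP; split=> // n [_ nm]; move: m0; rewrite -nm ltNge sqr_ge0.
Qed.

Definition theta (l : nat) (i : int) : laurent 'F_2 :=
  mklaurent (theta_subproof l i).

Definition gen_subalg (K : fieldType) (A : algType K) (G : set A) : set A :=
  [set x | forall B : {pred A},
     GRing.subalg_closed B -> (forall y, G y -> y \in B) -> x \in B].

Definition thetaS7 : set (laurent 'F_2) :=
  gen_subalg [set theta 7%N 1; theta 7%N 2; theta 7%N 3].

(* Main.v *)
(* Write a = [i], b = [2i], c = [4i].  Squaring a series in characteristic 2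
   doubles exponents, odd squares are 1 mod 8, and the even n = i (mod 7) are
   the 2m with m = 4i, so a = c^4 + a' with the exponents of a' all 1 mod 8, and
   cyclically in (a, b, c).  As 1/a = (a' + c^4) / a^2, each p_{2q,j}(1/a) is
   expressed through some p_{q,j'} of 1/a or of c^2/a; this yields
     p_{4,1}(1/a) = a' c^8 / a^4,   p_{8,3}(1/a) = a' p_{4,1}(1/a)^2,
     p_{16,6}(1/a) = ((c' c^8 / a^2)^2 p_{4,1}(1/a) + b^8 p_{8,3}(1/a))^2.
   Substituting u = s + t, v = s - t in the sum of the x^(u^2 + v^2) gives
   p_{2,0}(a b) = (b c)^2, that is
     a b + a^5 + b c^4 + b^2 c^2 = 0,
   and cyclically.  With these three relations a' c^8 / a^4 and c' c^8 / a^2 are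
   polynomials in a, b, c. *)

Require Import Defs.
From mathcomp Require Import all_boot all_order all_algebra.
From mathcomp Require Import mathcomp_extra boolp classical_sets functions.
From mathcomp Require Import cardinality fsbigop.
From mathcomp Require Import zify ring.

Set Implicit Arguments.
Unset Strict Implicit.
Unset Printing Implicit Defensive.

Import Order.TTheory GRing.Theory Num.Theory.
Local Open Scope classical_set_scope.
Local Open Scope ring_scope.

(** * Projections of Laurent series onto residue classes of exponents *)

Section Lproj.
Variable F : fieldType.
Implicit Types (f g h : laurent F).

Definition lsupp (q j : nat) f := forall n, (n != j %[mod q])%Z -> f n = 0.

Lemma laddE f g n : (f + g) n = f n + g n. Proof. by []. Qed.

Lemma lmul_coefE f g n : (f * g) n = \sum_(i \in [set: int]) f i * g (n - i).
Proof. by []. Qed.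

Lemma lprojE q j f n :
  lproj q j f n = if (n == j %[mod q])%Z then f n else 0.
Proof. by []. Qed.

Lemma lprojD q j f g : lproj q j (f + g) = lproj q j f + lproj q j g.
Proof. by apply: laurentP => n; rewrite laddE /=; case: ifP; rewrite ?addr0. Qed.

Lemma eqz_modB (q n i j k : int) : (i == k %[mod q])%Z ->
  (n - i == j %[mod q])%Z = (n == k + j %[mod q])%Z.
Proof.
rewrite !eqz_mod_dvd => ik.
have -> : n - i - j = (n - (k + j)) - (i - k) by ring.
exact: rpredBr.
Qed.

(** Multiplication by a series with exponents in the class of [k] shifts every residue class modulo
    [q] by [k], so [h] can be pulled out of a projection. *)
Lemma lprojM q j k h g : lsupp q k h ->
  lproj q (k + j) (h * g) = h * lproj q j g.
Proof.
move=> hk; apply: laurentP => n; rewrite lmul_coefE /= /lmul_coef PoszD.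
transitivity (\sum_(i \in [set: int])
    (if (n == k%:Z + j%:Z %[mod q])%Z then h i * g (n - i) else 0)).
  by case: ifP => // _; rewrite fsbig1.
apply: eq_fsbigr => i _.
have [ik|/hk ->] := boolP (i == k %[mod q])%Z; last by rewrite !mul0r if_same.
by rewrite (eqz_modB _ _ ik); case: ifP => // _; rewrite mulr0.
Qed.

Lemma lproj_lsupp q j f : lsupp q j f -> lproj q j f = f.
Proof. by move=> fj; apply: laurentP => n /=; case: ifPn => // /fj ->. Qed.

Lemma lproj_eq0 q d j k f : (d %| q)%N -> lsupp d k f ->
  (j != k %[mod d])%N -> lproj q j f = 0.
Proof.
move=> dq fk jk; apply: laurentP => n; rewrite lprojE [RHS]/= if_same.
case: ifP => // nj; apply: fk.
have {}nj : (n == j %[mod d])%Z.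
  by move: nj; rewrite !eqz_mod_dvd; apply: dvdz_trans.
by rewrite (eqP nj) !modz_nat.
Qed.

Lemma lsuppM q j k f g : lsupp q j f -> lsupp q k g -> lsupp q (j + k) (f * g).
Proof.
move=> fj gk n njk; rewrite -(lproj_lsupp gk) -(lprojM _ _ fj) /=.
by rewrite (negPf njk).
Qed.

Lemma lsuppW q d j f : (d %| q)%N -> lsupp q j f -> lsupp d j f.
Proof.
move=> dq fj n nj; apply: fj; apply: contraNN nj; rewrite !eqz_mod_dvd.
by apply: dvdz_trans.
Qed.

End Lproj.

(** * Squaring over the field with two elements *)

Section Square.
Implicit Types (f : laurent 'F_2).

Lemma addrr_F2 (x : 'F_2) : x + x = 0.
Proof. by rewrite -mulr2n -mulr_natr pchar_Zp ?mulr0. Qed.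

Lemma mulrr_F2 (x : 'F_2) : x * x = x.
Proof. by apply: val_inj; case: x => [[|[|n]] ltx]. Qed.

Lemma laurent_char2 : 2 = 0 :> laurent 'F_2.
Proof. by apply: laurentP => n; rewrite mulr2n laddE addrr_F2 /= if_same. Qed.

(** The reflection of [i] to [k - i] preserves each product, so all terms off the middle cancel in
    pairs; the middle one is a square in ['F_2], hence equal to its root. *)
Lemma sum_palindrome (k : nat) (u : nat -> 'F_2) :
  \sum_(i < k.+1) u i * u (k - i)%N = if odd k then 0 else u k./2.
Proof.
pose G i := u i * u (k - i)%N.
rewrite (bigID (fun i : 'I_k.+1 => (i.*2 < k)%N)) /=.
rewrite [X in _ + X](bigID (fun i : 'I_k.+1 => (i.*2 == k)%N)) /=.
rewrite addrCA [X in _ + (X + _)](reindex_inj rev_ord_inj) /=.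
rewrite [X in _ + (X + _)](eq_big (fun i : 'I_k.+1 => (k < i.*2)%N)
  (fun i : 'I_k.+1 => G i)); last 2 first.
- by move=> [i lti] /=; rewrite subSS; lia.
- by move=> [i lti] _ /=; rewrite /G mulrC subSS subKn.
rewrite [X in _ + (_ + X)](eq_bigl (fun i : 'I_k.+1 => (k < i.*2)%N)); last first.
  by move=> i; lia.
rewrite addrr_F2 addr0; case: ifP => ok.
  by rewrite big1// => i; lia.
have hk : (k./2 < k.+1)%N by lia.
rewrite (big_pred1 (Ordinal hk)) /=; last first.
  by move=> [i lti]; rewrite /= -val_eqE /=; lia.
by rewrite -[RHS]mulrr_F2; congr (_ * u _); lia.
Qed.

Lemma lsqr_coef f (n : int) :
  (f ^+ 2) n = if (2 %| n)%Z then f (n %/ 2)%Z else 0.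
Proof.
have [N fN] := Defs.lbound f.
have [nN|] := ltP n (N + N).
  rewrite expr2 [LHS](lmul_eq0 fN fN nN).
  by case: ifP => // n2; rewrite fN//; lia.
move=> /le_addnat[k ->]; rewrite expr2 [LHS](lmulE k fN fN).
rewrite (sum_palindrome k (fun i => f (N + i%:Z))).
have -> : (2 %| N + N + k)%Z = ~~ odd k by lia.
by rewrite if_neg; case: ifP => // ko; congr (f _); lia.
Qed.

Lemma lexp4_coef f (n : int) :
  (f ^+ 4) n = if (4 %| n)%Z then f (n %/ 4)%Z else 0.
Proof.
rewrite -[4%N]/(2 * 2)%N exprM !lsqr_coef.
case: (boolP (4 %| n)%Z) => [/dvdzP[m ->]|n4].
  rewrite ifT; last by lia.
  by rewrite ifT; [congr (f _)|]; lia.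
by do 2 case: ifP => //; lia.
Qed.

Lemma lsupp_sqr q j f : lsupp q j f -> lsupp (2 * q) (2 * j) (f ^+ 2).
Proof.
move=> fj n nj; rewrite lsqr_coef; case: ifP => // /dvdzP[m nE].
rewrite nE mulzK// fj//; apply: contraNN nj; rewrite !eqz_mod_dvd nE.
by rewrite !PoszM [m * _]mulrC -mulrBr dvdz_mul2l.
Qed.

Lemma lproj_sqr q j f : lproj (2 * q) (2 * j) (f ^+ 2) = lproj q j f ^+ 2.
Proof.
apply: laurentP => n; rewrite lprojE !lsqr_coef lprojE.
case: (boolP (2 %| n)%Z) => [/dvdzP[m ->]|]; last by rewrite if_same.
rewrite mulzK// !eqz_mod_dvd.
by rewrite !PoszM [m * _]mulrC -mulrBr dvdz_mul2l.
Qed.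

Lemma lsupp1 f : lsupp 1 0 f.
Proof. by move=> n; rewrite !modz1. Qed.

Lemma lsupp2_sqr f : lsupp 2 0 (f ^+ 2).
Proof. exact/(@lsupp_sqr 1 0)/lsupp1. Qed.

End Square.

(** * Theta series, their products and their odd parts *)

Section Theta.

Lemma int_parity (u : int) : exists k, u = 2 * k \/ u = 2 * k + 1.
Proof. by exists (u %/ 2)%Z; lia. Qed.

Lemma add_sub_inj (u v u' v' : int) :
  u + v = u' + v' -> u - v = u' - v' -> u = u' /\ v = v'.
Proof. by lia. Qed.

(** An even sum of squares forces [u] and [v] to have the same parity, so their half sum and half
    difference are integers. *)
Lemma sum_sqr_double (u v m : int) : u ^+ 2 + v ^+ 2 = m * 2 ->
  exists x y, [/\ u = x + y, v = x - y & x ^+ 2 + y ^+ 2 = m].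
Proof.
move=> uvm; have [x ux] : exists x, u + v = 2 * x.
  have [k ku] := int_parity u; have [k' k'v] := int_parity v.
  case: ku k'v uvm => -> [] -> uvm.
  - by exists (k + k'); lia.
  - by exfalso; lia.
  - by exfalso; lia.
  - by exists (k + k' + 1); lia.
have [uE vE] : u = x + (x - v) /\ v = x - (x - v) by lia.
by exists x, (x - v); split=> //; move: uvm; rewrite {1}uE {1}vE; lia.
Qed.

Lemma sqr_quadruple (u m : int) : u ^+ 2 = m * 4 ->
  exists2 k, u = 2 * k & k ^+ 2 = m.
Proof.
have [k [->|->]] := int_parity u => um; last by exfalso; lia.
by exists k => //; lia.
Qed.

Lemma sqr_mod8 (u : int) : ~~ (4 %| u ^+ 2)%Z -> (u ^+ 2 == 1 %[mod 8])%Z.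
Proof.
have [k [->|->]] := int_parity u; first by lia.
by have [k' [->|->]] := int_parity k; lia.
Qed.

Variable l : nat.
Implicit Types (i j s t m n : int).

Definition sqrt_class i m := [set u : int | (u = i %[mod l%:Z])%Z /\ u ^+ 2 = m].

(** Provides the finiteness needed to merge and exchange the finitely supported sums in
    [thetaM_coef]. *)
Lemma finite_bounded (A : set int) n :
  (forall u, A u -> `|u| <= n) -> finite_set A.
Proof.
move=> An; pose f (k : nat) : int := k%:Z - (absz n)%:Z.
apply: (@sub_finite_set _ _ (f @` `I_(2 * absz n).+1)).
  by move=> u /An un; exists (absz (u + (absz n)%:Z)); rewrite /f /=; lia.
exact/finite_image/finite_II.
Qed.

Lemma le_abs_sqr (u : int) : `|u| <= u ^+ 2.
Proof.
rewrite -real_normK ?num_real// expr2.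
have [->|u0] := eqVneq u 0; first by rewrite normr0 mulr0.
by rewrite ler_peMr// -gtz0_ge1 normr_gt0.
Qed.

Lemma finite_sqrt_class i m : finite_set (sqrt_class i m).
Proof. by apply: (@finite_bounded _ m) => u [_ <-]; exact: le_abs_sqr. Qed.

Definition sqrt_pairs i j n := [set p : int * int |
  [/\ (p.1 = i %[mod l%:Z])%Z, (p.2 = j %[mod l%:Z])%Z &
      p.1 ^+ 2 + p.2 ^+ 2 = n]].

Lemma finite_sqrt_pairs i j n : finite_set (sqrt_pairs i j n).
Proof.
pose A := [set u : int | `|u| <= n].
have fA : finite_set A by exact: (@finite_bounded _ n).
apply: (sub_finite_set _ (finite_setX fA fA)) => -[u v] [/= _ _ uvn].
split; rewrite /A /= -uvn.
  by rewrite (le_trans (le_abs_sqr _))// lerDl sqr_ge0.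
by rewrite (le_trans (le_abs_sqr _))// lerDr sqr_ge0.
Qed.

Lemma thetaM_coef i j n :
  (theta l i * theta l j) n = \sum_(p \in sqrt_pairs i j n) (1 : 'F_2).
Proof.
(* Outside [K] the product of coefficients vanishes: either [k] or [n - k] is negative, hence not a
   square. *)
pose K := [set k : int | `|k| <= n].
have fK : finite_set K by exact: (@finite_bounded _ n).
pose J k := [set p : int * int | p.1 ^+ 2 = k].
transitivity (\sum_(k \in K) \sum_(p \in sqrt_pairs i j n `&` J k) (1 : 'F_2)).
  rewrite lmul_coefE -(@fsbig_widen _ _ _ _ K)//; last first.
    move=> k [_ /= nk]; rewrite [LHS]/= /theta_coef.
    have [k0|k0] := ltP k 0.
      rewrite fsbig1 ?mul0r// => u [_ uk].
      by move: k0; rewrite -uk ltNge sqr_ge0.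
    rewrite [X in _ * X]fsbig1 ?mulr0// => u [_ uk]; exfalso; apply: nk.
    by rewrite /K /= ger0_norm// -subr_ge0 -uk sqr_ge0.
  apply: eq_fsbigr => k _.
  rewrite [theta l i k]/= [theta l j _]/= /theta_coef mulr_fsuml.
  under eq_fsbigr do rewrite mul1r.
  rewrite pair_fsbig; [|exact: finite_sqrt_class..].
  apply: eq_fsbigl; apply/seteqP; split=> -[u v] /=.
    by case=> -[ui uk] [vj vk]; split=> //; split=> //=; rewrite uk vk subrKC.
  case=> -[/= ui vj uvn] uk; split; split=> //.
  by rewrite -uvn uk addrAC subrr add0r.
(* After the exchange of sums, each pair [p] is counted for the single value [k = p.1 ^+ 2]. *)
under eq_fsbigr do rewrite fsbig_mkcondr.
rewrite exchange_fsbig//; last exact: finite_sqrt_pairs.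
apply: eq_fsbigr => p; rewrite inE => -[_ _ pn].
rewrite (fsbigD1 (p.1 ^+ 2))//=; last first.
  by rewrite /K /= ger0_norm ?sqr_ge0// -pn lerDl sqr_ge0.
rewrite ifT ?inE// fsbig1 ?addr0// => k [_ /= kp].
by rewrite ifF//; apply/negP; rewrite inE => /esym.
Qed.

Lemma eqz_mod_double s t : odd l ->
  (2 * s = 2 * t %[mod l%:Z])%Z -> (s = t %[mod l%:Z])%Z.
Proof.
move=> ol /eqP; rewrite eqz_mod_dvd -mulrBr Gauss_dvdzr.
  by rewrite -eqz_mod_dvd => /eqP.
by rewrite coprimezE /= coprimen2.
Qed.

(** The map from [(x, y)] to [(x + y, x - y)] doubles the sum of squares, and it matches the pairs
    in the classes of [s], [t] with those in the classes of [i], [j] whose sum of squares is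
    even. *)
Lemma lproj_thetaM i j s t : odd l ->
  (i = s + t %[mod l%:Z])%Z -> (j = s - t %[mod l%:Z])%Z ->
  lproj 2 0 (theta l i * theta l j) = (theta l s * theta l t) ^+ 2.
Proof.
move=> ol ist jst; apply: laurentP => n; rewrite lprojE lsqr_coef.
have -> : (n == 0%N %[mod 2%N])%Z = (2 %| n)%Z by lia.
case: ifP => // /dvdzP[m ->]; rewrite mulzK// !thetaM_coef.
apply: (reindex_fsbig (fun p : int * int => (p.1 + p.2, p.1 - p.2))).
split.
- move=> [u v] [/= us vt uvm]; split=> /=.
  + by rewrite ist -modzDm us vt modzDm.
  + by rewrite jst -modzDm us -modzNm vt modzNm modzDm.
  + by rewrite -uvm; ring.
- move=> [u v] [u' v'] _ _ [uv uv'].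
  by have [-> ->] := add_sub_inj uv uv'.
(* Surjectivity: the classes of [2 * x] and [2 * y] are known, and 2 is invertible modulo the odd
   [l]. *)
- move=> [u v] [/= ui vj uvm].
  have [x [y [uE vE xym]]] := sum_sqr_double uvm.
  exists (x, y); last by rewrite uE vE.
  split=> //=; apply: (eqz_mod_double ol).
  + rewrite (_ : 2 * x = u + v); last by rewrite uE vE; ring.
    by rewrite -modzDm ui vj ist jst modzDm; congr (_ %% _)%Z; ring.
  + rewrite (_ : 2 * y = u - v); last by rewrite uE vE; ring.
    rewrite -modzDm -modzNm ui vj ist jst modzNm modzDm.
    by congr (_ %% _)%Z; ring.
Qed.

Lemma theta_mod i j : (i = j %[mod l%:Z])%Z -> theta l i = theta l j.
Proof.
move=> ij; apply: laurentP => n; rewrite /= /theta_coef; apply: eq_fsbigl.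
by apply/seteqP; split=> u /=; rewrite ij.
Qed.

Lemma theta_opp i j : (i = - j %[mod l%:Z])%Z -> theta l i = theta l j.
Proof.
move=> ij; apply: laurentP => n; rewrite /= /theta_coef.
apply: (reindex_fsbig (fun u : int => - u)); split.
- by move=> u [uj <-]; split; rewrite ?sqrrN// ij -modzNm uj modzNm.
- by move=> u v _ _ /oppr_inj.
- move=> u [ui <-]; exists (- u); rewrite ?opprK//; split; rewrite ?sqrrN//.
  by rewrite -modzNm ui ij modzNm opprK.
Qed.

(** Even roots in the class of [i] are the doubles of the roots in the class of [h], so the fourth
    power cancels their contribution; odd roots have squares 1 modulo 8. *)
Lemma lsupp_theta_odd i h : odd l -> (i = 2 * h %[mod l%:Z])%Z ->
  lsupp 8 1 (theta l i + theta l h ^+ 4).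
Proof.
move=> ol ih n n8; rewrite laddE lexp4_coef.
case: ifPn => [/dvdzP[m nE]|n4]; last first.
  rewrite addr0 /= /theta_coef fsbig1// => u [_ un]; exfalso.
  by move: n8; rewrite -un sqr_mod8// un.
rewrite nE mulzK// -[RHS](addrr_F2 (theta l h m)); congr (_ + _).
rewrite /= /theta_coef; apply: (reindex_fsbig (fun u : int => 2 * u)); split.
- move=> u [uh <-]; split; last by ring.
  by rewrite ih -modzMmr uh modzMmr.
- by move=> u v _ _; apply: mulfI.
- move=> u [ui /sqr_quadruple[k uE km]]; exists k => //; split=> //.
  by apply: (eqz_mod_double ol); rewrite -uE ui.
Qed.

(** The coefficient at [r ^+ 2] is 1: the other root [- r] lies in the class of [r] only if [l]
    divides [2 * r]. *)
Lemma theta_neq0 (r : nat) : (0 < r < l)%N -> odd l -> theta l r != 0.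
Proof.
move=> rl ol; apply/eqP => /(congr1 (fun f : laurent 'F_2 => f (r%:Z ^+ 2))).
rewrite /= /theta_coef if_same (_ : mkset _ = [set r%:Z]) ?fsbig_set1//.
apply/seteqP; split=> [u [ur /eqP]|u ->]//=.
rewrite eqf_sqr => /orP[/eqP//|/eqP u_r]; move/eqP: ur.
rewrite u_r eqz_mod_dvd => lr.
have {lr} : (l %| 2 * r%:Z)%Z.
  by rewrite -rpredN; have -> : - (2 * r%:Z) = - r%:Z - r%:Z by ring.
rewrite Gauss_dvdzr; last by rewrite coprimezE /= coprimen2.
by case/andP: rl => r0 rl; rewrite dvdzE /= gtnNdvd.
Qed.

End Theta.

(** * Polynomial identities in characteristic 2 *)

Section Char2.
Variables (R : comNzRingType) (char2 : 2 = 0 :> R).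

Lemma add_eq0_char2 (x y : R) : x + y = 0 -> x = y.
Proof.
move=> xy; have /eqP := char2; rewrite -[2]/(1 + 1) addr_eq0 => /eqP m1.
by apply/eqP; rewrite -subr_eq0 -mulN1r -m1 mul1r xy.
Qed.

Lemma natr_even_char2 (n : nat) : ~~ odd n -> n%:R = 0 :> R.
Proof. by move=> /even_halfK <-; rewrite -mul2n natrM char2 mul0r. Qed.

End Char2.

(* [ring: h] cancels a monomial only when its coefficient is exactly the one on
   the left of [h], hence one rule per even coefficient that occurs; moving both
   sides to the left first makes the coefficients even. *)
Ltac ring2 h :=
  apply: (add_eq0_char2 h);
  ring: h (natr_even_char2 h (n := 4) isT) (natr_even_char2 h (n := 6) isT).

Definition theta_rel (R : comNzRingType) (x y z : R) :=
  x * y + x ^+ 5 + y * z ^+ 4 + y ^+ 2 * z ^+ 2.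

(** * Division by powers of [a] by means of the three relations *)

Section ThetaAlgebra.
Variables (L : fieldType) (a b c : L).
Hypotheses (char2 : 2 = 0 :> L) (a_neq0 : a != 0).
Hypotheses (rel_ab : theta_rel a b c = 0) (rel_bc : theta_rel b c a = 0).
Hypothesis rel_ca : theta_rel c a b = 0.

Let w := c + b ^+ 4 + a * b ^+ 2.
Let q := b * c + a * b ^+ 3 + a ^+ 2 * c ^+ 2.

Let c5E : c ^+ 5 = a * w.
Proof.
transitivity (a * w + theta_rel c a b); last by rewrite rel_ca addr0.
by rewrite /theta_rel /w; ring2 char2.
Qed.

Let b2c3E : b ^+ 2 * c ^+ 3 = a * q.
Proof.
(* In this combination [a ^+ 5 * c], [b * c ^+ 5] and [a * b ^+ 5] each occur twice and cancel;
   apart from [b ^+ 2 * c ^+ 3], what is left is divisible by [a]. *)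
transitivity (a * q + c * theta_rel a b c + a * theta_rel b c a +
  b * theta_rel c a b).
  by rewrite /theta_rel /q; ring2 char2.
by rewrite rel_ab rel_bc rel_ca !mulr0 !addr0.
Qed.

Let bcE : b * (c + b ^+ 4) = a ^+ 2 * c * (a ^+ 2 + c).
Proof.
transitivity (a ^+ 2 * c * (a ^+ 2 + c) + theta_rel b c a).
  by rewrite /theta_rel; ring2 char2.
by rewrite rel_bc addr0.
Qed.

Lemma theta_quotient4E : (a + c ^+ 4) * c ^+ 8 / a ^+ 4 =
  b ^+ 3 * c ^+ 3 * (a ^+ 2 + c) + b ^+ 4 * c ^+ 2 + q.
Proof.
apply: (canLR (mulfK _)); rewrite ?expf_neq0//.
(* The numerator is [a ^+ 2 * c ^+ 2 * w * (c + w)] by [c5E]. Expanding [w * (c + w)] leaves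
   [b ^+ 4 * (c + b ^+ 4)], [a * b ^+ 2 * c] and [a ^+ 2 * b ^+ 4]; [bcE] and, with the factor
   [c ^+ 2], [b2c3E] give the missing [a ^+ 2]. *)
transitivity (a ^+ 2 * b ^+ 3 * c ^+ 2 * (a ^+ 2 * c * (a ^+ 2 + c)) +
  a ^+ 4 * b ^+ 4 * c ^+ 2 + a ^+ 3 * (a * q)); last by ring.
rewrite -bcE -b2c3E.
transitivity (a * c ^+ 3 * c ^+ 5 + c ^+ 2 * (c ^+ 5) ^+ 2); first by ring.
by rewrite c5E /w; ring2 char2.
Qed.

Lemma theta_quotient2E : (c + b ^+ 4) * c ^+ 8 / a ^+ 2 =
  w + b ^+ 6 * q + a * b ^+ 4 * c ^+ 3 + b ^+ 2 * c ^+ 3 * w.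
Proof.
apply: (canLR (mulfK _)); rewrite ?expf_neq0//.
transitivity (a * (a * w) + a * b ^+ 6 * (a * q)
  + a ^+ 3 * b ^+ 4 * c ^+ 3 + a * (a * w) * b ^+ 2 * c ^+ 3); last by ring.
rewrite -b2c3E.
transitivity (c ^+ 3 * c ^+ 5 * (w + a * b ^+ 2)).
  by rewrite /w; ring2 char2.
transitivity (c ^+ 3 * (a * w) * w + c ^+ 3 * (a * w) * (a * b ^+ 2)).
  by rewrite c5E; ring.
(* Here [w ^+ 2] is expanded termwise; the second factor [a] comes from [c ^+ 5] by [c5E] and from
   [c ^+ 3 * b ^+ 8 = b ^+ 6 * (b ^+ 2 * c ^+ 3)] by [b2c3E]. *)
transitivity (a * c ^+ 3 * (c ^+ 2 + b ^+ 8 + a ^+ 2 * b ^+ 4)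
  + c ^+ 3 * (a * w) * (a * b ^+ 2)).
  by rewrite /w; ring2 char2.
by rewrite -c5E; ring2 char2.
Qed.

End ThetaAlgebra.

(** * Recursion for the projections of [a^-1] *)

Section Recursion.
Variables a b c : laurent 'F_2.
Hypotheses (a_neq0 : a != 0) (supp_a : lsupp 8 1 (a + c ^+ 4)).

(** By [supp_a] the first summand has only odd exponents, and the second, a square, only even ones;
    a projection to an even modulus therefore sees just one of them. *)
Lemma invr_splitE :
  a^-1 = (a + c ^+ 4) * a^-1 ^+ 2 + (c ^+ 2 * a^-1) ^+ 2 :> laurent 'F_2.
Proof.
transitivity (a * a^-1 * a^-1); first by rewrite mulfV// mul1r.
by ring2 laurent_char2.
Qed.

Lemma lproj_inv_odd q k : (2 * q %| 8)%N ->
  lproj (2 * q) (1 + 2 * k) a^-1 = (a + c ^+ 4) * lproj q k a^-1 ^+ 2.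
Proof.
move=> q8; rewrite {1}invr_splitE lprojD lprojM; last exact: lsuppW supp_a.
have k2 : (1 + 2 * k != 0 %[mod 2])%N by rewrite addnC mulnC modnMDl.
by rewrite lproj_sqr (lproj_eq0 (dvdn_mulr _ _) (lsupp2_sqr _) k2)// addr0.
Qed.

Lemma lproj_inv_even q k :
  lproj (2 * q) (2 * k) a^-1 = lproj q k (c ^+ 2 * a^-1) ^+ 2.
Proof.
have supp1 : lsupp 2 1 ((a + c ^+ 4) * a^-1 ^+ 2).
  exact: lsuppM (@lsuppW _ _ 2 _ _ _ supp_a) (lsupp2_sqr _).
have k2 : (2 * k != 1 %[mod 2])%N by rewrite modnMr.
rewrite {1}invr_splitE lprojD lproj_sqr.
by rewrite (lproj_eq0 (dvdn_mulr _ _) supp1 k2)// add0r.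
Qed.

Lemma lproj1 f : lproj 1 0 f = f :> laurent 'F_2.
Proof. exact/lproj_lsupp/lsupp1. Qed.

Lemma lproj20_inv : lproj 2 0 a^-1 = (c ^+ 2 * a^-1) ^+ 2.
Proof. by rewrite (lproj_inv_even 1 0) lproj1. Qed.

Lemma lproj41_inv : lproj 4 1 a^-1 = (a + c ^+ 4) * c ^+ 8 / a ^+ 4.
Proof. by rewrite (@lproj_inv_odd 2 0)// lproj20_inv -exprVn; ring. Qed.

Lemma lproj81_inv : lproj 8 1 a^-1 = (a + c ^+ 4) * c ^+ 24 / a ^+ 8.
Proof.
rewrite (@lproj_inv_odd 4 0)// (lproj_inv_even 2 0).
rewrite (@lprojM _ 2 0 0); last exact: lsupp2_sqr.
by rewrite lproj20_inv -exprVn; ring.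
Qed.

Lemma lproj83_inv : lproj 8 3 a^-1 = (a + c ^+ 4) * lproj 4 1 a^-1 ^+ 2.
Proof. exact: (@lproj_inv_odd 4 1). Qed.

Lemma lproj16_6_inv : lsupp 8 1 (c + b ^+ 4) ->
  lproj 16 6 a^-1 = (((c + b ^+ 4) * c ^+ 8 / a ^+ 2) ^+ 2 * lproj 4 1 a^-1
    + b ^+ 8 * lproj 8 3 a^-1) ^+ 2.
Proof.
move=> supp_c; rewrite (lproj_inv_even 8 3); congr (_ ^+ 2).
(* The exponents of [(c + b ^+ 4) ^+ 2] are 2 modulo 16 and those of [b ^+ 8] are 0 modulo 8, so
   class 3 modulo 8 is reached from classes 1 and 3 of [a^-1]. *)
have -> : c ^+ 2 * a^-1 = (c + b ^+ 4) ^+ 2 * a^-1 + b ^+ 8 * a^-1.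
  by ring2 laurent_char2.
rewrite lprojD (@lprojM _ 8 1 2); last first.
  exact: (@lsuppW _ 16) (lsupp_sqr supp_c).
rewrite (@lprojM _ 8 3 0); last first.
  rewrite -[b ^+ 8]/(b ^+ (2 * 2 * 2)) !exprM.
  exact/(@lsupp_sqr 4 0)/(@lsupp_sqr 2 0)/lsupp2_sqr.
by rewrite lproj81_inv lproj41_inv -!exprVn; congr (_ + _); ring.
Qed.

End Recursion.

(** * The relation among theta series modulo 7 *)

Lemma eqz_modMD (l i j k : int) : i = k * l + j -> (i = j %[mod l])%Z.
Proof. by move=> ->; rewrite modzMDl. Qed.

(** The even part of [a * b] is computed twice: as [(b * c) ^+ 2] by [lproj_thetaM], and from the
    splitting of [a] and [b] into odd parts and fourth powers. *)
Lemma theta7_rel (i j k : int) :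
    (j = 2 * i %[mod 7%:Z])%Z -> (k = 4 * i %[mod 7%:Z])%Z ->
  theta_rel (theta 7 i) (theta 7 j) (theta 7 k) = 0.
Proof.
move=> /theta_mod -> /theta_mod ->.
(* The multipliers 5 and 3 solve [s + t = i], [s - t = 2 * i] modulo 7; up to sign they are 2 and
   4. *)
have theta5 : theta 7 (5 * i) = theta 7 (2 * i).
  by apply/theta_opp/(@eqz_modMD _ _ _ i); ring.
have theta3 : theta 7 (3 * i) = theta 7 (4 * i).
  by apply/theta_opp/(@eqz_modMD _ _ _ i); ring.
set a := theta 7 i; set b := theta 7 (2 * i); set c := theta 7 (4 * i).
have supp_a : lsupp 2 1 (a + c ^+ 4).
  apply: (@lsuppW _ 8) => //; apply: lsupp_theta_odd => //.
  by apply: (@eqz_modMD _ _ _ (- i)); ring.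
have supp_b : lsupp 2 1 (b + a ^+ 4).
  by apply: (@lsuppW _ 8) => //; apply: lsupp_theta_odd.
have supp4 (f : laurent 'F_2) : lsupp 2 0 (f ^+ 4).
  by rewrite -[4%N]/(2 * 2)%N exprM; exact: lsupp2_sqr.
have : lproj 2 0 (a * b) = (b * c) ^+ 2.
  rewrite (@lproj_thetaM 7 _ _ (5 * i) (3 * i))//.
  - by rewrite theta5 theta3.
  - by apply: (@eqz_modMD _ _ _ (- i)); ring.
  - by congr (_ %% _)%Z; ring.
have -> : a * b = (a + c ^+ 4) * (b + a ^+ 4) + c ^+ 4 * a ^+ 4
    + ((a + c ^+ 4) * a ^+ 4 + c ^+ 4 * (b + a ^+ 4)).
  by ring2 laurent_char2.
rewrite 3!lprojD.
rewrite [X in X + _ + _]lproj_lsupp; last first.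
  by move=> n n2; apply: (lsuppM supp_a supp_b); lia.
rewrite [X in _ + X + _](lproj_lsupp (lsuppM (supp4 _) (supp4 _))).
rewrite (lproj_eq0 _ (lsuppM supp_a (supp4 _)))//.
rewrite (lproj_eq0 _ (lsuppM (supp4 _) supp_b))//.
rewrite !addr0 => abE.
transitivity ((b * c) ^+ 2 + ((a + c ^+ 4) * (b + a ^+ 4) + c ^+ 4 * a ^+ 4)).
  by rewrite /theta_rel; ring2 laurent_char2.
by rewrite abE; ring2 laurent_char2.
Qed.

(** * Membership in the generated subalgebra *)

Section GenSubalg.
Variables (K : fieldType) (A : algType K) (G : set A).
Implicit Types x y : A.

Lemma gen_subalg_gen x : G x -> gen_subalg G x.
Proof. by move=> Gx B _; exact. Qed.

Lemma gen_subalg1 : gen_subalg G 1.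
Proof. by move=> B [? _ _] _. Qed.

Lemma gen_subalgD x y : gen_subalg G x -> gen_subalg G y ->
  gen_subalg G (x + y).
Proof.
move=> xG yG B hB hG; have [_ BZ _] := hB.
by rewrite -[x]scale1r BZ ?xG ?yG.
Qed.

Lemma gen_subalgM x y : gen_subalg G x -> gen_subalg G y ->
  gen_subalg G (x * y).
Proof.
by move=> xG yG B hB hG; have [_ _ BM] := hB; rewrite BM ?xG ?yG.
Qed.

Lemma gen_subalgX x n : gen_subalg G x -> gen_subalg G (x ^+ n).
Proof.
move=> xG; elim: n => [|n IHn]; first exact: gen_subalg1.
by rewrite exprS; exact: gen_subalgM.
Qed.

End GenSubalg.

Ltac gen_subalg_auto :=
  do ![assumption | apply: gen_subalgD | apply: gen_subalgM
      | apply: gen_subalgX].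

(** Every nonzero class modulo 7 is one of 1, 2, 3 up to sign; this covers the indices [2 * r] and
    [4 * r], which may exceed 3. *)
Lemma thetaS7_theta (r : nat) : ~~ (7 %| r)%N -> thetaS7 (theta 7 r).
Proof.
move=> r7; rewrite (@theta_mod 7 r (r %% 7)%N); last first.
  by rewrite -modz_nat modz_mod.
have thetaS7_opp i j : (i = - j %[mod 7%:Z])%Z ->
    thetaS7 (theta 7 j) -> thetaS7 (theta 7 i) by move=> /theta_opp ->.
have m1 : thetaS7 (theta 7 1) by apply: gen_subalg_gen; left; left.
have m2 : thetaS7 (theta 7 2) by apply: gen_subalg_gen; left; right.
have m3 : thetaS7 (theta 7 3) by apply: gen_subalg_gen; right.
move: r7 (ltn_pmod r (isT : 0 < 7)%N); rewrite /dvdn.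
case: (r %% 7)%N => [|[|[|[|[|[|[|]]]]]]] // _ _.
- exact: (@thetaS7_opp 4 3).
- exact: (@thetaS7_opp 5 2).
- exact: (@thetaS7_opp 6 1).
Qed.

Theorem theorem5p2 (r : nat) (hr : (1 <= r <= 3)%N) :
  let a : laurent 'F_2 := theta 7%N r%:Z in
  [/\ thetaS7 (lproj 4%N 1%N a^-1),
      thetaS7 (lproj 8%N 3%N a^-1) &
      thetaS7 (lproj 16%N 6%N a^-1)].
Proof.
move=> a; pose b := theta 7 (2 * r%:Z); pose c := theta 7 (4 * r%:Z).
have a_neq0 : a != 0.
  by apply: theta_neq0 => //; case/andP: hr => -> /leq_ltn_trans ->.
have rel_ab : theta_rel a b c = 0 by exact: theta7_rel.
(* Since 8 is 1 modulo 7, doubling the index permutes [a], [b], [c] cyclically. *)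
have rel_bc : theta_rel b c a = 0.
  apply: theta7_rel; first by congr (_ %% _)%Z; ring.
  by apply: (@eqz_modMD _ _ _ (- r%:Z)); ring.
have rel_ca : theta_rel c a b = 0.
  apply: theta7_rel; first by apply: (@eqz_modMD _ _ _ (- r%:Z)); ring.
  by apply: (@eqz_modMD _ _ _ (- (2 * r%:Z))); ring.
have supp_a : lsupp 8 1 (a + c ^+ 4).
  by apply: lsupp_theta_odd => //; apply: (@eqz_modMD _ _ _ (- r%:Z)); ring.
have supp_c : lsupp 8 1 (c + b ^+ 4).
  by apply: lsupp_theta_odd => //; congr (_ %% _)%Z; ring.
have n7 : [/\ ~~ (7 %| r)%N, ~~ (7 %| 2 * r)%N & ~~ (7 %| 4 * r)%N].
  by case: r hr {a b c a_neq0 rel_ab rel_bc rel_ca supp_a supp_c}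
    => [|[|[|[|]]]].
have [r7 r27 r47] := n7.
have aS : thetaS7 a by exact: thetaS7_theta.
have bS : thetaS7 b by rewrite /b -PoszM; exact: thetaS7_theta.
have cS : thetaS7 c by rewrite /c -PoszM; exact: thetaS7_theta.
have p41S : thetaS7 (lproj 4 1 a^-1).
  rewrite (lproj41_inv a_neq0 supp_a).
  rewrite (theta_quotient4E laurent_char2 a_neq0 rel_ab rel_bc rel_ca).
  by gen_subalg_auto.
have p83S : thetaS7 (lproj 8 3 a^-1).
  rewrite (lproj83_inv a_neq0 supp_a).
  by gen_subalg_auto.
split=> //; rewrite (lproj16_6_inv a_neq0 supp_a supp_c).
rewrite (theta_quotient2E laurent_char2 a_neq0 rel_ab rel_bc rel_ca).
by gen_subalg_auto.
Qed.
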